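(* Let $\Gamma$ be a distance-regular graph with classical parameters $(D,b,\alpha,\beta)$ such that $b\ge 2$ and $D\ge 3$, and let $r=[D]$. If $\beta \geq \frac{1}{3}(8\alpha b + 8b + 5\alpha)r$, then $\Gamma$ has the SPLS$(\lfloor \frac{4r}{3}\rfloor)$ property. In particular, in this case $\alpha$ is an integer with $0\le \alpha\le b$.
   Context: Distance-regular graph with intersection numbers $b_i,c_i$, valency $k=b_0$, $a_i = k-b_i-c_i$. For integer $b\ne 1$, $[j]=\frac{b^j-1}{b-1}$. Classical parameters $(D,b,\alpha,\beta)$ means diameter $D$, $b_i=([D]-[i])(\beta-\alpha[i])$ ($0\le i\le D-1$), $c_i=[i](1+\alpha[i-1])$ ($1\le i\le D$). A partial linear space is an incidence structure of points and lines in which any two distinct points lie on at most one common line; its point graph has the points as vertices, two distinct points adjacent iff they lie on a common line. For a partial linear space $X$, $\tau(X)$ is the maximum, over pairs of a point $x$ and a line $\ell$ not through $x$, of the number of points of $\ell$ collinear with $x$. For integers $c\ge 1$, $s\ge 2$, a distance-regular graph $\Gamma$ has the SPLS$(c,s)$ property if: $\Gamma$ is the point graph of a partial linear space $X=(V(\Gamma),\mathcal L,\in)$ where $\mathcal L$ is the set of all maximal cliques of $\Gamma$ with at least $a_1+2-(c-1)(s-1)$ vertices; $a_1\ge (2s-1)(c-1)$; each vertex lies on at most $s$ lines; and $\tau(X)\le c$. SPLS$(s)$ means SPLS$(c_2,s)$. *)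

(* Defs.v *)
From HB Require Import structures.
From mathcomp Require Import all_boot all_order all_algebra.
Set Implicit Arguments. Unset Strict Implicit. Unset Printing Implicit Defensive.
Import Order.TTheory GRing.Theory Num.Theory.

Section Graphs.
Variables (V : finType) (E : rel V).

Definition simple_graph : Prop := symmetric E /\ irreflexive E.

Fixpoint ball (x : V) (n : nat) : {set V} :=
  if n is m.+1 then ball x m :|: [set z | [exists w in ball x m, E w z]]
  else [set x].

Definition at_dist (x y : V) (n : nat) : bool :=
  (y \in ball x n) && ((n == 0%N) || (y \notin ball x n.-1)).

Definition distance_regular (D : nat) (b c : nat -> nat) : Prop :=
  simple_graph /\
  (forall x y : V, y \in ball x D) /\
  (exists x y : V, at_dist x y D) /\
  (forall (i : nat) (x y : V), at_dist x y i ->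
     ((i < D)%N -> #|[set z | E y z && at_dist x z i.+1]| = b i) /\
     ((1 <= i <= D)%N -> #|[set z | E y z && at_dist x z i.-1]| = c i)).

Definition is_clique (A : {set V}) : bool :=
  [forall x in A, forall y in A, (x != y) ==> E x y].

Definition is_maxclique (A : {set V}) : bool :=
  is_clique A && [forall B : {set V}, (is_clique B && (A \subset B)) ==> (B == A)].

Definition a1 (b c : nat -> nat) : int := (b 0%N)%:Z - (b 1%N)%:Z - (c 1%N)%:Z.

Definition SPLS_lines (b c : nat -> nat) (cc s : nat) : {set {set V}} :=
  [set A : {set V} | is_maxclique A &&
     (a1 b c + 2 - (cc%:Z - 1) * (s%:Z - 1) <= (#|A|)%:Z)%R].

Definition collinear (L : {set {set V}}) (x y : V) : bool :=
  [exists l in L, (x \in l) && (y \in l)].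

Definition SPLS (b c : nat -> nat) (cc s : nat) : Prop :=
  let L := SPLS_lines b c cc s in
  (1 <= cc)%N /\ (2 <= s)%N /\
  (forall x y : V, x != y -> forall l1 l2, l1 \in L -> l2 \in L ->
      x \in l1 -> y \in l1 -> x \in l2 -> y \in l2 -> l1 = l2) /\
  (forall x y : V, x != y -> (E x y <-> collinear L x y)) /\
  ((((2 * s)%:Z - 1) * (cc%:Z - 1) <= a1 b c)%R) /\
  (forall x : V, (#|[set l in L | x \in l]| <= s)%N) /\
  (forall (x : V) (l : {set V}), l \in L -> x \notin l ->
      (#|[set y in l | collinear L x y]| <= cc)%N).

End Graphs.

(* [j] = (b^j - 1)/(b - 1) = 1 + b + ... + b^(j-1), for b <> 1 *)
Definition qint (b j : nat) : nat := (\sum_(k < j) b ^ k)%N.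

Section Classical.
Variable R : numDomainType.
Local Open Scope ring_scope.
Definition classical_params (bi ci : nat -> nat) (D b : nat) (alpha beta : R) : Prop :=
  (forall i : nat, (i < D)%N ->
     (bi i)%:R = ((qint b D)%:R - (qint b i)%:R) * (beta - alpha * (qint b i)%:R)) /\
  (forall i : nat, (1 <= i <= D)%N ->
     (ci i)%:R = (qint b i)%:R * (1 + alpha * (qint b i.-1)%:R)).
End Classical.

(* Main.v *)
(** In the neighbourhood of a vertex cocliques have at most [s] elements, since [s + 1]
    pairwise nonadjacent neighbours would cover more than [k] vertices; a greedy argument
    then shows that every edge is on a unique large maximal clique ("line") and every
    vertex on at most [s] of them (Bruck-Metsch completion).

    For the bound on [alpha], put [r = qint b D]; [- r] is the least eigenvalue of the
    adjacency matrix [A], because it has a cosine sequence with alternating signs. A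
    clique has at most [1 + beta] vertices (Delsarte), so every vertex is on at least [r]
    lines. There are fewer lines than vertices, hence a nonzero vector [z] summing to zero
    on each line, and [A z = - T z] with [T] the diagonal matrix of the numbers of lines
    on the vertices; as [A + r] is positive semidefinite, the vertices in the support of
    [z] are on exactly [r] lines, all of size [1 + beta]. A vertex outside a line of that
    size and adjacent to one of its vertices is adjacent to [1 + alpha] of them, so
    [alpha] is an integer. If [y] is in the support and [x] is at distance 2 from [y],
    then [b + 1] lines on [y] meet the neighbourhood of [x]; some such [x] is on a line
    with [1 + alpha] neighbours of [y], which lie on distinct lines among those [b + 1]. *)
Require Import Defs.
From HB Require Import structures.
From mathcomp Require Import all_boot all_order all_algebra.
From mathcomp Require Import zify ring lra.
Import Order.TTheory GRing.Theory Num.Theory.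

Set Implicit Arguments. Unset Strict Implicit. Unset Printing Implicit Defensive.

(** * Completion to a partial linear space *)

Section Cliques.
Variables (V : finType) (E : rel V).
Hypothesis Esym : symmetric E.

Lemma is_cliqueP (A : {set V}) :
  reflect {in A &, forall x y, x != y -> E x y} (is_clique E A).
Proof.
apply: (iffP forallP) => [h x y xA yA xy|h x].
  by have /implyP/(_ xA)/forallP/(_ y)/implyP/(_ yA)/implyP/(_ xy) := h x.
by apply/implyP => xA; apply/forallP => y; apply/implyP => yA; apply/implyP; apply: h.
Qed.

Lemma is_maxcliqueP (A : {set V}) :
  reflect (is_clique E A /\ forall x, {in A, forall y, x != y -> E x y} -> x \in A)
    (is_maxclique E A).
Proof.
apply: (iffP andP) => -[cA mA]; split=> //.
  move=> x hx; have /implyP := forallP mA (x |: A).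
  rewrite subsetUr andbT => mx.
  suff /mx/eqP <- : is_clique E (x |: A) by rewrite setU11.
  apply/is_cliqueP => y z /setU1P[->|yA] /setU1P[->|zA]; rewrite ?eqxx // => yz.
  - exact: hx.
  - by rewrite Esym; apply: hx; rewrite // eq_sym.
  - exact: (is_cliqueP _ cA).
apply/forallP => B; apply/implyP => /andP[cB sAB].
rewrite eqEsubset sAB andbT; apply/subsetP => x xB; apply: mA => y yA xy.
by apply: (is_cliqueP _ cB) => //; apply: (subsetP sAB).
Qed.

Lemma maxclique_nonadj (A : {set V}) x : is_maxclique E A -> x \notin A ->
  exists2 y, y \in A & (x != y) && ~~ E x y.
Proof.
move=> /is_maxcliqueP[_ mA] xA; have [/existsP[y /and3P[? ? ?]]|] :=
  boolP [exists y, [&& y \in A, x != y & ~~ E x y]]; first by exists y => //; apply/andP.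
rewrite negb_exists => /forallP h; case/negP: xA; apply: mA => y yA xy.
by have := h y; rewrite yA xy /= negbK.
Qed.

Lemma clique_extends (A : {set V}) : is_clique E A ->
  exists2 B, is_maxclique E B & A \subset B.
Proof.
move=> cA.
have [B /maxsetP[cB mB] sAB] := maxset_exists (P := is_clique E) cA.
exists B => //; rewrite /is_maxclique cB; apply/forallP => C.
by apply/implyP => /andP[cC sBC]; apply/eqP; apply: mB.
Qed.

End Cliques.

(** * Large maximal cliques as lines, and cocliques in the neighbourhood of a vertex *)

Section Completion.
Variables (V : finType) (E : rel V) (lam m s : nat).
Hypothesis (Esym : symmetric E) (Eirr : irreflexive E).
Hypothesis lamE : forall x y, E x y -> #|[set z | E x z && E y z]| = lam.
Hypothesis muE : forall x y, x != y -> ~~ E x y -> #|[set z | E x z && E y z]| <= m.+1.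
Hypothesis s_gt0 : 0 < s.
Hypothesis lam_ge : (s.*2 - 1) * m <= lam.

(** With [lam] $= a_1$ and [m] $= c_2 - 1$ this is the size bound $a_1 + 2 - (s-1)(c_2-1)$,
    rearranged to avoid truncated subtraction. *)
Definition is_line (l : {set V}) := is_maxclique E l && (lam + 2 <= #|l| + (s - 1) * m).

Lemma line_size l : is_line l -> s * m + 2 <= #|l|.
Proof. by case/andP => _; case: s s_gt0 lam_ge => // s' _ h1 h2; nia. Qed.

Lemma line_clique l : is_line l -> {in l &, forall x y, x != y -> E x y}.
Proof. by case/andP => /andP[/is_cliqueP h _] _. Qed.

(** By maximality some [y] in [l] is not adjacent to [x], and the neighbours of [x] in [l] are
    common neighbours of [x] and [y]. *)
Lemma line_nbrs l x : is_line l -> x \notin l -> #|[set v in l | E x v]| <= m.+1.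
Proof.
move=> ll xl; have [y yl /andP[xy nE]] := maxclique_nonadj Esym (andP ll).1 xl.
apply: leq_trans (muE xy nE); apply/subset_leq_card/subsetP => v.
rewrite !inE => /andP[vl Exv]; rewrite Exv (line_clique ll) //.
by apply: contraNneq nE => ->.
Qed.

(** Distinct lines share at most $m+1$ vertices, and their union lies in the [lam + 2] vertices
    formed by [x], [y] and their common neighbours; the sizes of the lines then contradict
    [lam_ge]. *)
Lemma line_inj l1 l2 x y : is_line l1 -> is_line l2 -> x != y ->
  x \in l1 -> y \in l1 -> x \in l2 -> y \in l2 -> l1 = l2.
Proof.
move=> L1 L2 xy x1 y1 x2 y2; apply/eqP; case/boolP: (l1 == l2) => // ne; exfalso.
have Exy : E x y by apply: (line_clique L1).
have [q q2 q1] : exists2 q, q \in l2 & q \notin l1.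
  apply/subsetPn; apply: contra ne => /subsetP sub; rewrite eqEsubset; apply/andP; split.
    apply/subsetP => z z1; have /(is_maxcliqueP Esym)[_] := (andP L2).1; apply=> w /sub.
    exact: (line_clique L1).
  exact/subsetP.
have cI : #|l1 :&: l2| <= m.+1.
  apply: leq_trans (line_nbrs L1 q1); apply/subset_leq_card/subsetP => v.
  rewrite !inE => /andP[v1 v2]; rewrite v1 (line_clique L2) //.
  by apply: contraNneq q1 => ->.
have cU : #|l1 :|: l2| <= lam + 2.
  have <- : #|x |: (y |: [set z | E x z && E y z])| = lam + 2.
    by rewrite !cardsU1 !inE !Eirr (negPf xy) lamE ?andbF // addnA addnC.
  apply/subset_leq_card/subsetP => v; rewrite !inE => hv.
  have [//|vx /=] := eqVneq v x; have [//|vy /=] := eqVneq v y.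
  rewrite !(eq_sym v) in vx vy.
  by case/orP: hv => hv; apply/andP; split; [apply: (line_clique L1) |
    apply: (line_clique L1) | apply: (line_clique L2) | apply: (line_clique L2)].
have := leq_add cU cI; rewrite cardsUI => le; have /andP[_ h1] := L1; have /andP[_ h2] := L2.
have e : (s.*2 - 1) * m = m + ((s - 1) * m).*2.
  by rewrite doubleMl -mulSn; congr (_ * _); move: s_gt0; clear; lia.
by move: lam_ge h1 h2 le; rewrite e; clear; lia.
Qed.

Lemma card_nonadj (A B : {set V}) n : {in B, forall w, #|[set v in A | E w v]| <= n} ->
  #|A| <= #|[set v in A | [forall w in B, ~~ E w v]]| + #|B| * n.
Proof.
move=> h; rewrite -sum1_card.
apply: (@leq_trans (\sum_(v in A) ([forall w in B, ~~ E w v] + \sum_(w in B) E w v))).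
  apply: leq_sum => v vA; have [//|] := boolP [forall w in B, ~~ E w v].
  rewrite negb_forall => /existsP[w]; rewrite negb_imply negbK => /andP[wB Ewv].
  by rewrite (bigD1 w) //= Ewv.
rewrite big_split /=; apply: leq_add.
  rewrite -sum1_card big_mkcond [leqRHS]big_mkcond; apply: leq_sum => v _.
  by rewrite !inE; case: (v \in A) => //=; case: ifP.
rewrite exchange_big /= -sum_nat_const; apply: leq_sum => w wB.
apply: leq_trans (h w wB); rewrite -sum1_card big_mkcond [leqRHS]big_mkcond.
by apply: leq_sum => v _; rewrite !inE; case: (v \in A) => //=; case: ifP.
Qed.

Definition coclique_at x (Y : {set V}) :=
  (Y \subset [set z | E x z]) && [forall y in Y, forall z in Y, ~~ E y z].

Lemma coclique_atP x (Y : {set V}) :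
  reflect ({in Y, forall y, E x y} /\ {in Y &, forall y z, ~~ E y z}) (coclique_at x Y).
Proof.
apply: (iffP andP) => -[h1 h2]; split.
- by move=> y yY; have := subsetP h1 y yY; rewrite inE.
- by move=> y z yY zY; have /implyP/(_ yY)/forallP/(_ z)/implyP/(_ zY) := forallP h2 y.
- by apply/subsetP => y yY; rewrite inE h1.
- apply/forallP => y; apply/implyP => yY; apply/forallP => z; apply/implyP => zY.
  exact: h2.
Qed.

Lemma coclique_subset x (Y Z : {set V}) : Z \subset Y -> coclique_at x Y -> coclique_at x Z.
Proof.
move=> /subsetP sub /coclique_atP[h1 h2]; apply/coclique_atP; split=> [y /sub|y z /sub yY /sub zY].
  exact: h1.
exact: h2.
Qed.

Lemma coclique_setU1 x v (Y : {set V}) : coclique_at x Y -> E x v ->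
  {in Y, forall w, ~~ E w v} -> coclique_at x (v |: Y).
Proof.
move=> /coclique_atP[h1 h2] Exv h; apply/coclique_atP; split.
  by move=> y /setU1P[->|/h1].
move=> y z /setU1P[->|yY] /setU1P[->|zY]; rewrite ?Eirr //.
- by rewrite Esym; apply: h.
- exact: h.
- exact: h2.
Qed.

Let cl x y := [set z | E x z && ((z == y) || E y z)].

Lemma card_cl x y : E x y -> #|cl x y| = lam.+1.
Proof.
move=> Exy; have -> : cl x y = y |: [set z | E x z && E y z].
  by apply/setP => z; rewrite !inE andb_orr; case: eqVneq => [->|_]; rewrite ?Exy ?andbF.
by rewrite cardsU1 !inE Eirr andbF lamE.
Qed.

(** The bound is [m] and not [m.+1] because [x] itself is a common neighbour of [y] and [z] outside
    both sets. *)
Lemma card_clI x y z : E x y -> E x z -> y != z -> ~~ E y z -> #|cl x y :&: cl x z| <= m.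
Proof.
move=> Exy Exz yz nyz; have := muE yz nyz.
rewrite (cardsD1 x) !inE Esym Exy Esym Exz ltnS.
apply/leq_trans/subset_leq_card/subsetP => v; rewrite !inE.
have [->|_] /= := eqVneq v x; first by rewrite Eirr.
case/and3P => /andP[_ /orP[/eqP->|Eyv]] _ /orP[/eqP vz|Ezv].
- by rewrite vz eqxx in yz.
- by rewrite Esym Ezv in nyz.
- by rewrite -vz Eyv in nyz.
- by rewrite Eyv Ezv.
Qed.

(** Starting from [y], one vertex is added on each line. A vertex already chosen has at most [m]
    neighbours besides [x] on the next line, so at most [s * m] of its at least [s * m + 1] vertices
    other than [x] are excluded. *)
Lemma greedy_coclique x y (ls : seq {set V}) : E x y -> uniq ls -> size ls <= s ->
  {in ls, forall l, [/\ is_line l, x \in l & y \notin l]} ->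
  exists2 Y, coclique_at x Y &
    #|Y| = (size ls).+1 /\ {in Y, forall w, w = y \/ exists2 l, l \in ls & w \in l}.
Proof.
move=> Exy; elim: ls => [|l ls IH] /=.
  move=> _ _ _; exists [set y]; last by rewrite cards1; split=> // w /set1P; left.
  by apply/coclique_atP; split=> [z /set1P->//|z w /set1P-> /set1P->]; rewrite Eirr.
case/andP => nl ul sz h.
have [|Y cY [cardY hY]] := IH ul (ltnW sz).
  by move=> l' l'ls; apply: h; rewrite inE l'ls orbT.
have [ll xl yl] := h l (mem_head _ _).
have /coclique_atP[h1 h2] := cY.
have Yl w : w \in Y -> w \notin l.
  move=> wY; have xw : x != w by apply: contraTneq (h1 w wY) => ->; rewrite Eirr.
  case: (hY w wY) => [->//|[l' l'ls wl']]; apply: contra nl => wl.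
  have [|ll' xl' _] := h l'; first by rewrite inE l'ls orbT.
  by rewrite (line_inj ll ll' xw xl wl xl' wl').
have [v] : exists v, v \in [set v in l :\ x | [forall w in Y, ~~ E w v]].
  apply/card_gt0P.
  have /card_nonadj : {in Y, forall w, #|[set v in l :\ x | E w v]| <= m}.
    move=> w wY; rewrite -ltnS; apply: leq_trans (line_nbrs ll (Yl w wY)).
    rewrite (cardsD1 x [set v in l | E w v]) !inE xl Esym h1 // add1n ltnS.
    by apply/subset_leq_card/subsetP => v; rewrite !inE -andbA.
  have := line_size ll; rewrite (cardsD1 x l) xl cardY; nia.
rewrite !inE => /andP[/andP[vx vl] /forallP vY].
have vY' : {in Y, forall w, ~~ E w v} by move=> w wY; apply: (implyP (vY w)).
exists (v |: Y).
  by apply: coclique_setU1 => //; apply: (line_clique ll) => //; rewrite eq_sym.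
split.
  by rewrite cardsU1 cardY (contraL (Yl v)).
move=> w /setU1P[->|/hY[->|[l' l'ls wl']]]; [right; exists l|left|right; exists l'] => //.
  exact: mem_head.
by rewrite inE l'ls orbT.
Qed.

Variable k : nat.
Hypothesis degE : forall x, #|[set z | E x z]| = k.
(** Twice the Bonferroni bound: $s+1$ sets of size [lam + 1] meeting pairwise in at most [m]
    elements cover more than [k]. *)
Hypothesis k_lt : k.*2 + s.+1 * s * m < s.+1.*2 * lam.+1.

(* Double counting of the closed neighbourhoods of [Y] inside the neighbourhood
   of [x], through [3 e <= 2 + e ^ 2] for the number [e] of those containing a point. *)
Lemma coclique_le x (Y : {set V}) : coclique_at x Y -> #|Y| <= s.
Proof.
move=> cY; rewrite leqNgt; apply/negP => ltY.
wlog cardY : Y cY ltY / #|Y| = s.+1.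
  move=> wl; have [Z /andP[sZ /eqP cZ]] : exists Z : {set V}, (Z \subset Y) && (#|Z| == s.+1).
    have /card_gt0P[Z] : 0 < #|[set Z : {set V} | (Z \subset Y) && (#|Z| == s.+1)]|.
      by rewrite cards_draws bin_gt0.
    by rewrite inE; exists Z.
  by apply: (wl Z); rewrite ?cZ //; apply: coclique_subset cY.
have /coclique_atP[h1 h2] := cY.
pose e z := \sum_(y in Y) (z \in cl x y : nat).
have e1 : \sum_(z in [set z | E x z]) e z = s.+1 * lam.+1.
  rewrite exchange_big /= -cardY -sum_nat_const; apply: eq_bigr => y yY.
  rewrite -(card_cl (h1 y yY)) -sum1_card [RHS]big_mkcond [LHS]big_mkcond /=.
  by apply: eq_bigr => z _; rewrite !inE; case: (E x z) => //=; case: (_ || _).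
have e2 : \sum_(z in [set z | E x z]) e z * e z <= s.+1 * lam.+1 + s.+1 * s * m.
  under eq_bigr do rewrite big_distrl /=.
  rewrite exchange_big /= -mulnA -mulnDr -{1}cardY -sum_nat_const; apply: leq_sum => y yY.
  under eq_bigr do rewrite big_distrr /=.
  rewrite exchange_big /= (bigD1 y) //=; apply: leq_add.
    rewrite -(card_cl (h1 y yY)) -sum1_card [leqRHS]big_mkcond [leqLHS]big_mkcond /=.
    by apply: leq_sum => z _; rewrite !inE; case: (E x z) => //=; case: (_ || _).
  apply: (@leq_trans (\sum_(i in Y :\ y) m)); last first.
    by move: cardY; rewrite sum_nat_const (cardsD1 y) yY add1n => -[<-]; rewrite mulnC.
  rewrite (eq_bigl (fun i => i \in Y :\ y)); last by move=> i; rewrite !inE andbC.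
  apply: leq_sum => y'; rewrite !inE => /andP[ny y'Y].
  have yy' : y != y' by rewrite eq_sym.
  apply: leq_trans (card_clI (h1 y yY) (h1 y' y'Y) yy' (h2 y y' yY y'Y)).
  rewrite -sum1_card [leqRHS]big_mkcond [leqLHS]big_mkcond /=.
  by apply: leq_sum => z _; rewrite !inE; case: (E x z) => //=; do 2 case: (_ || _).
have e3 : \sum_(z in [set z | E x z]) 3 * e z <=
          \sum_(z in [set z | E x z]) (2 + e z * e z).
  by apply: leq_sum => z _; case: (e z) => // -[|n] //; nia.
move: e3; rewrite -big_distrr /= e1 big_split /= sum_nat_const degE.
by move: e2 k_lt => /=; nia.
Qed.

(** Given $s+1$ lines on [x], a second vertex [y] of one and the greedy choice on [s] others would
    form a coclique of size $s+1$. *)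
Lemma card_lines x : #|[set l | is_line l & x \in l]| <= s.
Proof.
rewrite leqNgt; apply/negP; rewrite cardE.
set L := enum _; have LP l : l \in L -> is_line l /\ x \in l.
  by rewrite mem_enum inE => /andP.
have uL : uniq L by apply: enum_uniq.
case: L LP uL => // l0 L LP /= /andP[nl uL] sz.
have [ll xl] := LP l0 (mem_head _ _).
have [y] : exists y, y \in l0 :\ x.
  by apply/card_gt0P; have := line_size ll; rewrite (cardsD1 x) xl; lia.
rewrite !inE eq_sym => /andP[xy yl].
have szs : size (take s L) = s by rewrite size_takel.
have [||||Y cY [cardY _]] := @greedy_coclique x y (take s L); rewrite ?szs //.
- exact: (line_clique ll).
- exact: take_uniq.
- move=> l /mem_take lL; have [|l1 l2] := LP l; first by rewrite inE lL orbT.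
  split=> //; apply: contra nl => yl'.
  by rewrite (line_inj ll l1 xy).
by have := coclique_le cY; rewrite cardY szs ltnn.
Qed.

(** The vertices of [cl x y] nonadjacent to the rest of [Y] form a clique, as two nonadjacent ones
    could replace [y]; at most $(s-1)m$ vertices of [cl x y] are lost, so together with [x] it
    extends to a line. *)
Lemma maximum_coclique_line x y (Y : {set V}) : coclique_at x Y ->
  (forall Z, coclique_at x Z -> #|Z| <= #|Y|) -> y \in Y ->
  exists l, [/\ is_line l, x \in l & y \in l].
Proof.
move=> cY mY yY; have /coclique_atP[h1 h2] := cY.
pose K := [set v in cl x y | [forall w in Y :\ y, ~~ E w v]].
have yK : y \in K.
  rewrite !inE eqxx h1 //=; apply/forallP => w; apply/implyP.
  by rewrite !inE => /andP[_ wY]; apply: h2.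
have KP v : v \in K -> E x v /\ {in Y :\ y, forall w, ~~ E w v}.
  rewrite !inE => /andP[/andP[Exv _] /forallP h]; split=> // w wY.
  exact: (implyP (h w)).
have KY v : v \in K -> v \notin Y :\ y.
  rewrite !inE; case: eqVneq => //= vy /andP[/andP[_ Eyv] _].
  by apply: contraTN Eyv => vY; apply: h2.
have cK : {in K &, forall u v, u != v -> E u v}.
  move=> u v uK vK uv; apply/negPn/negP => nuv.
  have [Exu hu] := KP u uK; have [Exv hv] := KP v vK.
  have cZ : coclique_at x (u |: (v |: Y :\ y)).
    apply: coclique_setU1 => //; last first.
      by move=> w /setU1P[->|/hu //]; rewrite Esym.
    by apply: coclique_setU1 => //; apply: coclique_subset cY; apply: subsetDl.
  have := mY _ cZ; rewrite !cardsU1 (KY v) // in_setU1 (negPf uv) (KY u) //.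
  by rewrite [X in _ <= X](cardsD1 y) yY !add1n ltnn.
have [|l ml sl] := @clique_extends _ E (x |: K).
  apply/is_cliqueP => u v /setU1P[->|uK] /setU1P[->|vK]; rewrite ?eqxx // => uv.
  - exact: (KP v vK).1.
  - by rewrite Esym; apply: (KP u uK).1.
  - exact: cK.
exists l; split; rewrite ?(subsetP sl) ?setU11 ?setU1r //.
rewrite /is_line ml /=.
have := subset_leq_card sl; rewrite cardsU1.
have -> : x \notin K by rewrite !inE Eirr.
have /card_nonadj : {in Y :\ y, forall w, #|[set v in cl x y | E w v]| <= m}.
  move=> w /setD1P[wy wY]; have yw : y != w by rewrite eq_sym.
  apply: leq_trans (card_clI (h1 y yY) (h1 w wY) yw (h2 _ _ yY wY)).
  apply/subset_leq_card/subsetP => v; rewrite !inE => /andP[/andP[-> ->] ->].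
  by rewrite orbT.
rewrite card_cl ?h1 // -/K.
have : #|Y :\ y| * m <= (s - 1) * m.
  by rewrite leq_mul2r; have := coclique_le cY; rewrite (cardsD1 y) yY; lia.
lia.
Qed.

(** Otherwise the greedy choice, started at [y], on the lines joining [x] to the members of a
    maximum coclique would give a larger coclique. *)
Lemma edge_line x y : E x y -> exists l, [/\ is_line l, x \in l & y \in l].
Proof.
move=> Exy; have c0 : coclique_at x set0.
  by apply/coclique_atP; split=> [z|z w]; rewrite inE.
case: (arg_maxnP (fun Y : {set V} => #|Y|) c0) => Y cY mY.
have /coclique_atP[h1 h2] := cY.
pose P (l : {set V}) := [&& is_line l, x \in l & y \in l].
have [/existsP[l /and3P]|/existsPn nl] := boolP [exists l, P l]; first by exists l.
pose f w := odflt set0 [pick l | [&& is_line l, x \in l & w \in l]].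
have fP w : w \in Y -> [/\ is_line (f w), x \in f w & w \in f w].
  move=> wY; rewrite /f; case: pickP => [l /and3P//|none].
  have [l [l1 l2 l3]] := maximum_coclique_line cY mY wY.
  by have := none l; rewrite l1 l2 l3.
have [||||Z cZ [cardZ _]] := @greedy_coclique x y [seq f w | w <- enum Y];
  rewrite ?size_map -?cardE //.
- rewrite map_inj_in_uniq ?enum_uniq // => u v; rewrite !mem_enum => uY vY fuv.
  have [lu xu uu] := fP u uY; have [_ _] := fP v vY; rewrite -fuv => vu.
  by apply: contraNeq (h2 u v uY vY) => uv; apply: (line_clique lu).
- exact: coclique_le cY.
- move=> l /mapP[w]; rewrite mem_enum => /fP[l1 l2 _] ->; split=> //.
  by have := nl (f w); rewrite /P l1 l2.
by have := mY Z cZ; rewrite /= cardZ size_map -cardE; rewrite ltnn.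
Qed.

End Completion.

(** * Distances *)

Section Balls.
Variables (V : finType) (E : rel V).
Hypothesis Esym : symmetric E.

Lemma ballS x n z :
  (z \in ball E x n.+1) = (z \in ball E x n) || [exists w in ball E x n, E w z].
Proof. by rewrite !inE. Qed.

Lemma ball_leq x m n : m <= n -> ball E x m \subset ball E x n.
Proof.
elim: n => [|n IH]; first by rewrite leqn0 => /eqP->.
rewrite leq_eqVlt => /predU1P[->//|/IH sub].
by apply: subset_trans sub _; apply: subsetUl.
Qed.

Lemma ball_edge_head x y z n : E y x -> z \in ball E x n -> z \in ball E y n.+1.
Proof.
move=> Eyx; elim: n z => [|n IH] z.
  move=> /set1P->; rewrite ballS; apply/orP; right.
  by apply/existsP; exists y; rewrite set11.
rewrite ballS => /orP[/IH h|/existsP[w /andP[/IH h Ewz]]]; rewrite ballS.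
  by rewrite h.
by apply/orP; right; apply/existsP; exists w; rewrite h.
Qed.

Lemma ball_sym x y n : y \in ball E x n -> x \in ball E y n.
Proof.
elim: n x y => [|n IH] x y; first by move=> /set1P->; apply/set1P.
rewrite ballS => /orP[/IH|/existsP[w /andP[/IH h Ewy]]].
  by apply: subsetP; apply: ball_leq.
by apply: (ball_edge_head _ h); rewrite Esym.
Qed.

End Balls.

Section Distance.
Variables (V : finType) (E : rel V) (D : nat) (b c : nat -> nat).
Hypothesis drg : distance_regular E D b c.

Let Esym : symmetric E := drg.1.1.
Let Eirr : irreflexive E := drg.1.2.

Definition dist (x y : V) : nat := ex_minn (ex_intro (fun n => y \in ball E x n) D (drg.2.1 x y)).

Lemma mem_ball x y n : (y \in ball E x n) = (dist x y <= n).
Proof.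
rewrite /dist; case: ex_minnP => m ym min; apply/idP/idP; first exact: min.
by move=> /ball_leq-/(_ V E x)/subsetP; apply.
Qed.

Lemma at_distE x y n : at_dist E x y n = (dist x y == n).
Proof.
rewrite /at_dist !mem_ball; case: n => [|n] /=; first by rewrite andbT leqn0.
by rewrite -ltnNge andbC [RHS]eq_sym [RHS]eqn_leq.
Qed.

Lemma dist_le x y : dist x y <= D.
Proof. by rewrite -mem_ball; apply: drg.2.1. Qed.

Lemma dist_sym x y : dist x y = dist y x.
Proof.
suff le u v : dist u v <= dist v u by apply/eqP; rewrite eqn_leq !le.
by rewrite -mem_ball; apply: ball_sym => //; rewrite mem_ball.
Qed.

Lemma dist_eq0 x y : (dist x y == 0) = (x == y).
Proof. by rewrite -leqn0 -mem_ball in_set1 eq_sym. Qed.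

Lemma dist_xx x : dist x x = 0.
Proof. by apply/eqP; rewrite dist_eq0. Qed.

Lemma dist_edge x y z : E y z -> dist x z <= (dist x y).+1.
Proof.
move=> Eyz; rewrite -mem_ball ballS; apply/orP; right; apply/existsP; exists y.
by rewrite mem_ball leqnn.
Qed.

Lemma dist_pred x y n : dist x y = n.+1 -> exists2 z, E y z & dist x z = n.
Proof.
move=> dxy; have : y \in ball E x n.+1 by rewrite mem_ball dxy.
rewrite ballS mem_ball dxy ltnn => /existsP[z /andP[]]; rewrite mem_ball => le Ezy.
exists z; first by rewrite Esym.
by apply/eqP; rewrite eqn_leq le -ltnS -dxy dist_edge.
Qed.

Lemma dist_eq1 x y : (dist x y == 1) = E x y.
Proof.
apply/idP/idP => [/eqP/dist_pred[z Eyz /eqP]|Exy].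
  by rewrite dist_eq0 => /eqP->; rewrite Esym.
have := dist_edge x Exy; rewrite dist_xx leq_eqVlt ltnS leqn0 dist_eq0.
by case/orP => // /eqP xy; rewrite xy Eirr in Exy.
Qed.

Lemma dist_eq2 x y z : x != y -> ~~ E x y -> E x z -> E z y -> dist x y = 2.
Proof.
move=> xy; rewrite -dist_eq1 -dist_eq0 in xy * => nE; rewrite -dist_eq1 => /eqP xz.
by move/(dist_edge x); rewrite xz; case: (dist x y) xy nE => [|[|[]]].
Qed.

Lemma sphere_nonempty i : i <= D -> exists x y, dist x y = i.
Proof.
move=> iD; have [x [y]] := drg.2.2.1; rewrite at_distE => /eqP dxy.
exists x; suff h j : j <= D -> exists z, dist x z = D - j.
  by have [z dz] := h (D - i) (leq_subr _ _); exists z; rewrite dz subKn.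
elim: j => [|j IH] jD; first by exists y; rewrite subn0.
have [z dz] := IH (ltnW jD).
have [|z' _ dz'] := @dist_pred x z (D - j.+1); first by rewrite dz subnSK.
by exists z'.
Qed.

(* The intersection numbers extended by [b_D = 0] and [c_0 = 0], values that
   [distance_regular] leaves unconstrained. *)
Definition bext i := if i < D then b i else 0.
Definition cext i := if 0 < i then c i else 0.

Lemma card_succ x y : #|[set z | E y z && (dist x z == (dist x y).+1)]| = bext (dist x y).
Proof.
rewrite /bext; case: ltnP => [lt|ge].
  rewrite -((drg.2.2.2 (dist x y) x y _).1 lt) ?at_distE //.
  by apply: eq_card => z; rewrite !inE at_distE.
apply: eq_card0 => z; rewrite !inE; apply/negP => /andP[_ /eqP h].
by have := dist_le x z; rewrite h; lia.
Qed.

Lemma card_pred x y :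
  #|[set z | E y z && ((dist x z).+1 == dist x y)]| = cext (dist x y).
Proof.
rewrite /cext; case: posnP => [->|gt].
  by apply: eq_card0 => z; rewrite !inE andbF.
have h : 1 <= dist x y <= D by rewrite gt dist_le.
rewrite -((drg.2.2.2 (dist x y) x y _).2 h) ?at_distE //.
by apply: eq_card => z; rewrite !inE at_distE; case: (dist x y) gt.
Qed.

Lemma degreeE (D_gt0 : 0 < D) x : #|[set z | E x z]| = b 0.
Proof.
have := card_succ x x; rewrite dist_xx /bext D_gt0 => <-.
by apply: eq_card => z; rewrite !inE dist_eq1 andbb.
Qed.

Lemma b_gt0 i : i < D -> 0 < b i.
Proof.
move=> iD; have [x [z dxz]] := sphere_nonempty iD.
have [y Ezy dxy] := dist_pred dxz.
have := card_succ x y; rewrite dxy /bext iD => <-; apply/card_gt0P; exists z.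
by rewrite inE Esym Ezy dxz eqxx.
Qed.

Lemma c_gt0 i : 0 < i <= D -> 0 < c i.
Proof.
case: i => // i iD; have [x [y dxy]] := sphere_nonempty iD.
have [z Eyz dxz] := dist_pred dxy.
have := card_pred x y; rewrite dxy /cext /= => <-; apply/card_gt0P; exists z.
by rewrite inE Eyz dxz eqxx.
Qed.

Section Sums.
Variable R : comNzRingType.
Local Open Scope ring_scope.

(** Neighbours of [y] at the same distance from [x] contribute zero; the others are counted by
    [bext] and [cext]. *)
Lemma sum_nbrs_dist (D_gt0 : (0 < D)%N) (f : nat -> R) x y :
  \sum_(z | E y z) (f (dist x y) - f (dist x z)) =
    (bext (dist x y))%:R * (f (dist x y) - f (dist x y).+1) +
    (cext (dist x y))%:R * (f (dist x y) - f (dist x y).-1).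
Proof.
pose i := dist x y.
have sumE (p : pred V) (a : R) :
    \sum_(z | E y z) (if p z then a else 0) = #|[set z | E y z && p z]|%:R * a.
  rewrite -big_mkcondr /= sumr_const mulr_natl; congr (_ *+ _).
  by apply: eq_card => z; rewrite !inE.
rewrite -card_succ -card_pred -!sumE -big_split /=; apply: eq_bigr => z Eyz.
rewrite -/i; have le1 : (dist x z <= i.+1)%N := dist_edge x Eyz.
have le2 : (i <= (dist x z).+1)%N by apply: dist_edge; rewrite Esym.
case: eqP => [->|ne1]; first by rewrite ifF ?addr0 //; apply/eqP; lia.
case: eqP => [<-|ne2]; first by rewrite add0r.
suff -> : dist x z = i by rewrite subrr add0r.
by lia.
Qed.

End Sums.
End Distance.

(** * Common neighbours of two vertices *)

Section Intersections.
Variables (V : finType) (E : rel V) (D : nat) (b c : nat -> nat).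
Hypothesis drg : distance_regular E D b c.
Hypothesis D_ge2 : 1 < D.

Lemma card_common_adj x y : E x y -> (#|[set z | E x z && E y z]|%:Z = a1 b c)%R.
Proof.
move=> Exy; have dxy : dist drg x y = 1 by apply/eqP; rewrite dist_eq1.
(* For the indicator of distance 1 the sum is $b_0$ minus the number of common neighbours. *)
have := sum_nbrs_dist drg (ltnW D_ge2) (fun i => (i == 1)%:Z)%R x y.
rewrite dxy GRing.sumrB /= /bext D_ge2 /cext /= !GRing.subr0 !GRing.mulr1.
rewrite GRing.sumr_const (_ : #|_| = b 0); last first.
  by rewrite -(degreeE drg (ltnW D_ge2) y); apply: eq_card => z; rewrite inE.
have -> : (\sum_(z | E y z) (dist drg x z == 1)%:Z = #|[set z | E x z && E y z]|%:Z)%R.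
  rewrite -sum1_card -natz natr_sum big_mkcond [RHS]big_mkcond /=.
  by apply: eq_bigr => z _; rewrite inE dist_eq1 andbC; do 2 case: (E _ z).
by rewrite /a1 => h; lia.
Qed.

Lemma card_common_nonadj x y : x != y -> ~~ E x y -> #|[set z | E x z && E y z]| <= c 2.
Proof.
move=> xy nE; have [->|[z]] := set_0Vmem [set z | E x z && E y z]; first by rewrite cards0.
rewrite inE => /andP[Exz Eyz].
have dxy : dist drg x y = 2.
  by apply: (dist_eq2 drg (z := z)) => //; rewrite drg.1.1.
have := card_pred drg x y; rewrite dxy /cext /= => <-.
apply/subset_leq_card/subsetP => t; rewrite !inE -(dist_eq1 drg) => /andP[/eqP-> ->].
by rewrite eqxx.
Qed.

Lemma card_common_dist2 x y : dist drg x y = 2 -> #|[set z | E x z && E y z]| = c 2.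
Proof.
move=> dxy; have := card_pred drg x y; rewrite dxy /cext /= => <-.
by apply: eq_card => t; rewrite !inE -(dist_eq1 drg) andbC.
Qed.

End Intersections.

(** * Sums over lines, and vectors summing to zero on every line *)

Section LineSums.
Variables (V : finType) (E : rel V) (L : {set {set V}}).
Hypothesis L_edge : forall x y, E x y <-> x != y /\ exists l, [/\ l \in L, x \in l & y \in l].
Hypothesis L_inj : forall l1 l2 x y, l1 \in L -> l2 \in L -> x != y ->
  x \in l1 -> y \in l1 -> x \in l2 -> y \in l2 -> l1 = l2.

Lemma sum_over_lines (R : nmodType) (F : V -> R) x :
  (\sum_(l in L | x \in l) \sum_(y in l :\ x) F y = \sum_(y | E x y) F y)%R.
Proof.
transitivity (\sum_(y | E x y) \sum_(l in L | (x \in l) && (y \in l)) F y)%R.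
  rewrite (exchange_big_dep (E x)) /=; last first.
    move=> l y /andP[lL xl]; rewrite !inE => /andP[yx yl]; apply/L_edge; split.
      by rewrite eq_sym.
    by exists l.
  apply: eq_bigr => y /L_edge[xy _]; apply: eq_bigl => l.
  by rewrite !inE eq_sym xy -andbA.
apply: eq_bigr => y /L_edge[xy [l [lL xl yl]]].
rewrite (big_pred1 l) // => l'; apply/idP/eqP => [/and3P[l'L xl' yl']|->].
  exact: L_inj l'L lL xy xl' yl' xl yl.
by rewrite lL xl.
Qed.
End LineSums.

(** The incidence matrix has more rows than columns, hence a nonzero vector in its left kernel. *)
Lemma exists_zero_sum (F : fieldType) (T : finType) (L : {set {set T}}) :
  #|L| < #|T| -> exists2 z : T -> F, (exists x, z x != 0%R) &
    {in L, forall l : {set T}, (\sum_(x in l) z x = 0)%R}.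
Proof.
move=> lt; pose M : 'M[F]_(#|T|, #|L|) :=
  (\matrix_(i, j) (enum_val i \in (enum_val j : {set T}))%:R)%R.
have /rowV0Pn[v /sub_kermxP vM v0] : kermx M != 0%R.
  by rewrite kermx_eq0 /row_free ltn_eqF // (leq_ltn_trans (rank_leq_col M)).
exists (fun x => v 0%R (enum_rank x)) => [|l lL].
  by have /rV0Pn[i vi] := v0; exists (enum_val i); rewrite enum_valK.
have /matrixP/(_ 0%R (enum_rank_in lL l)) := vM; rewrite !mxE => e.
rewrite -[RHS]e (reindex_onto (@enum_rank T) (@enum_val T predT)) /=; last first.
  by move=> i _; rewrite enum_valK.
rewrite big_mkcond; apply: eq_big => [x|x _]; first by rewrite enum_rankK eqxx.
by rewrite mxE enum_rankK enum_rankK_in //; case: ifP; rewrite ?GRing.mulr1 ?GRing.mulr0.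
Qed.

(** * Arithmetic of $[j]$ *)

Lemma qintS b j : qint b j.+1 = qint b j + b ^ j.
Proof. by rewrite /qint big_ord_recr. Qed.

Lemma qint0 b : qint b 0 = 0.
Proof. by rewrite /qint big_ord0. Qed.

Lemma qint1 b : qint b 1 = 1.
Proof. by rewrite qintS qint0. Qed.

Lemma qint2 b : qint b 2 = 1 + b.
Proof. by rewrite qintS qint1 expn1. Qed.

Lemma ltn_qint b i j : 0 < b -> i < j -> qint b i < qint b j.
Proof.
move=> b0; elim: j => // j IH; rewrite ltnS leq_eqVlt qintS.
have h : 0 < b ^ j by rewrite expn_gt0 b0.
by case/predU1P => [->|/IH]; lia.
Qed.

Lemma qint_ge7 b n : 1 < b -> 2 < n -> 7 <= qint b n.
Proof.
move=> b2 n3; apply: (@leq_trans (qint b 3)); first by rewrite qintS qint2; nia.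
by move: n3; rewrite leq_eqVlt => /predU1P[->//|/ltn_qint h]; apply/ltnW/h/ltnW.
Qed.

Local Open Scope ring_scope.

(** * The least eigenvalue *)

Lemma sum_sqr_eq0 (R : realFieldType) (I : finType) (f : I -> R) :
  \sum_i f i ^+ 2 = 0 -> forall i, f i = 0.
Proof.
move=> h i; apply/eqP; rewrite -sqrf_eq0; apply/eqP.
by move: i (erefl true); apply: psumr_eq0P h => i _; apply: sqr_ge0.
Qed.

Lemma cauchy_schwarz (R : realFieldType) (I : finType) (f g : I -> R) :
  (\sum_i f i * g i) ^+ 2 <= (\sum_i f i ^+ 2) * \sum_i g i ^+ 2.
Proof.
set q := \sum_i f i * g i; set F := \sum_i f i ^+ 2; set G := \sum_i g i ^+ 2.
have F0 : 0 <= F by apply: sumr_ge0 => i _; apply: sqr_ge0.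
have [Fz|Fnz] := eqVneq F 0.
  by rewrite Fz mul0r /q big1 ?expr0n // => i _; rewrite (sum_sqr_eq0 Fz) mul0r.
have : 0 <= \sum_i (F * g i - q * f i) ^+ 2 by apply: sumr_ge0 => i _; apply: sqr_ge0.
have -> : \sum_i (F * g i - q * f i) ^+ 2 = F * (F * G - q ^+ 2).
  transitivity (\sum_i (F ^+ 2 * g i ^+ 2 + - (2 * F * q) * (f i * g i) + q ^+ 2 * f i ^+ 2)).
    by apply: eq_bigr => i _; ring.
  by rewrite !big_split /= -!mulr_sumr -/F -/G -/q; ring.
by rewrite pmulr_rge0 ?subr_ge0 // lt_neqAle eq_sym Fnz.
Qed.

(** By Bernoulli $x^{2^n} \ge 1 + n(x-1)$, which is unbounded for $x > 1$ in an Archimedean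
    field. *)
Lemma power_bounded_le1 (R : archiRealFieldType) (x M : R) :
  0 <= x -> (forall n, x ^+ (2 ^ n) <= M) -> x <= 1.
Proof.
move=> x0 h; rewrite leNgt; apply/negP => x1.
have bern n : 1 + n%:R * (x - 1) <= x ^+ n.
  elim: n => [|n IH]; first by rewrite mul0r addr0 expr0.
  have := ler_wpM2l x0 IH; rewrite -exprS; apply: le_trans.
  rewrite -natr1; have : 0 <= n%:R * (x - 1) ^+ 2 by rewrite mulr_ge0 ?sqr_ge0.
  by nra.
have M0 : 0 <= M by apply: le_trans (h 0%N); rewrite exprn_ge0.
have e0 : 0 < x - 1 by rewrite subr_gt0.
have := archi_boundP (divr_ge0 M0 (ltW e0)); set n := Num.bound _.
rewrite ltr_pdivrMr // => lt.
have := le_trans (bern (2 ^ n)%N) (h n).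
have : n%:R * (x - 1) <= (2 ^ n)%:R * (x - 1).
  by apply: ler_wpM2r; [exact: ltW | rewrite ler_nat ltnW // ltn_expl].
lra.
Qed.

(** The radial Laplacian of the indicator of [i]; it yields the three-term recurrence of
    [sphere_sum_rec]. *)
Lemma radial_delta (R : comNzRingType) (B C : nat -> R) i j : C 0%N = 0 ->
  let f l : R := if l == i then 1 else 0 in
  B j * (f j - f j.+1) + C j * (f j - f j.-1) =
  (B i + C i) * f j - C i.+1 * (if j == i.+1 then 1 else 0) -
  (if i is l.+1 then B l else 0) * (if j == i.-1 then 1 else 0).
Proof.
move=> C0 /=; have [->|ji] := eqVneq j i.
  rewrite (gtn_eqF (ltnSn i)) (ltn_eqF (ltnSn i)).
  case: i => [|l] /=; first by rewrite C0; ring.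
  by rewrite (ltn_eqF (ltnSn l)) (gtn_eqF (ltnSn l)); ring.
have [->|ji1] := eqVneq j i.+1.
  rewrite /= eqxx (gtn_eqF (leqnSn i.+1)).
  case: i {ji} => [|l] /=; first by ring.
  by rewrite (@gtn_eqF l l.+2); [ring|lia].
case: i j ji ji1 => [|l] [|j] //= ji ji1; rewrite ?C0.
- by rewrite eqSS in ji1; rewrite (negPf ji1); ring.
- by rewrite eqSS [0%N == l]eq_sym; case: eqP => [->|_]; ring.
- rewrite (_ : (j == l.+1) = false); last by apply/negbTE; rewrite eqSS in ji1.
  by rewrite eqSS; case: eqP => [<-|_]; ring.
Qed.

(** * The Laplacian and its action on functions of the distance *)

Section Spectrum.
Variables (R : archiRealFieldType) (V : finType) (E : rel V) (D : nat) (b c : nat -> nat).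
Hypothesis drg : distance_regular E D b c.
Hypothesis D_gt0 : (0 < D)%N.

Let Esym : symmetric E := drg.1.1.
Local Notation d := (dist drg).
Let B i : R := (bext D b i)%:R.
Let C i : R := (cext c i)%:R.

(** This is $k - A$, so the least eigenvalue of [A] corresponds to the greatest one here. *)
Definition laplacian (f : V -> R) (y : V) : R := \sum_(z | E y z) (f y - f z).

Definition radial_laplacian (f : nat -> R) (i : nat) : R :=
  B i * (f i - f i.+1) + C i * (f i - f i.-1).

Lemma laplacian_radial (f : nat -> R) x y :
  laplacian (fun y => f (d x y)) y = radial_laplacian f (d x y).
Proof. exact: sum_nbrs_dist. Qed.

Lemma eq_laplacian f g : f =1 g -> laplacian f =1 laplacian g.
Proof. by move=> fg y; apply: eq_bigr => z _; rewrite !fg. Qed.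

Lemma laplacian_sum (I : finType) (F : I -> V -> R) (a : I -> R) y :
  laplacian (fun y => \sum_i F i y * a i) y = \sum_i laplacian (F i) y * a i.
Proof.
rewrite /laplacian; under eq_bigr do rewrite -sumrB.
rewrite exchange_big /=; apply: eq_bigr => i _; rewrite mulr_suml.
by apply: eq_bigr => z _; rewrite mulrBl.
Qed.

Lemma laplacian_adjoint f g : \sum_y laplacian f y * g y = \sum_y f y * laplacian g y.
Proof.
have h (p q : V -> R) : \sum_y laplacian p y * q y =
    \sum_y (\sum_(z | E y z) p y * q y - \sum_(z | E y z) p z * q y).
  by apply: eq_bigr => y _; rewrite mulr_suml -sumrB; apply: eq_bigr => z _; rewrite mulrBl.
under [RHS]eq_bigr do rewrite mulrC.
rewrite !h !sumrB; congr (_ - _).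
  by apply: eq_bigr => y _; apply: eq_bigr => z _; rewrite mulrC.
rewrite (exchange_big_dep xpredT) //=; apply: eq_bigr => z _.
by apply: eq_big => [y|y _]; rewrite ?(Esym z) // mulrC.
Qed.

Lemma iter_laplacian_adjoint n f g :
  \sum_y iter n laplacian f y * g y = \sum_y f y * iter n laplacian g y.
Proof.
elim: n f g => //= n IH f g; rewrite laplacian_adjoint IH.
by apply: eq_bigr => y _; rewrite -iterS iterSr.
Qed.

(** Powers of the Laplacian have kernels depending on the distance alone, obtained by iterating the
    radial operator on the point mass at 0. *)
Lemma iter_laplacian n f y :
  iter n laplacian f y =
    \sum_x iter n radial_laplacian (fun i => (i == 0)%:R) (d x y) * f x.
Proof.
elim: n y => [|n IH] y /=.
  rewrite (bigD1 y) //= dist_xx mul1r big1 ?addr0 // => x xy.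
  by rewrite dist_eq0 (negPf xy) mul0r.
by rewrite (eq_laplacian IH) laplacian_sum; apply: eq_bigr => x _; rewrite laplacian_radial.
Qed.

Variables (w : nat -> R) (K : R).
Hypothesis w0 : w 0%N = 1.
Hypothesis w_gt0 : forall i, (i <= D)%N -> 0 < w i.
Hypothesis K_gt0 : 0 < K.
(** Equivalently, $(-1)^i w_i$ is an eigenvector of the radial Laplacian with eigenvalue [K]. *)
Hypothesis wE : forall i, (i <= D)%N ->
  B i * (w i + w i.+1) + C i * (w i + w i.-1) = K * w i.

Let B_D : B D = 0.
Proof. by rewrite /B /bext ltnn. Qed.

(** The triangle inequality turns the differences in the radial Laplacian into the sums of [wE]. *)
Lemma radial_bound n i : (i <= D)%N ->
  `|iter n radial_laplacian (fun i => (i == 0)%:R) i| <= K ^+ n * w i.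
Proof.
elim: n i => [|n IH] i iD /=.
  case: eqP => [->|_]; first by rewrite w0 normr1 mulr1.
  by rewrite normr0 mul1r ltW // w_gt0.
set m := iter n _ _ in IH *.
apply: le_trans (ler_normD _ _) _.
rewrite exprSr -mulrA -(wE iD) [leRHS]mulrDr !normrM !(mulrCA (K ^+ n)).
have B0 : 0 <= B i by rewrite ler0n.
have C0 : 0 <= C i by rewrite ler0n.
rewrite (ger0_norm B0) (ger0_norm C0); apply: lerD.
  (* Nothing is known at index $D+1$, but for $i = D$ its coefficient [B D] vanishes. *)
  have [lt|ge] := ltnP i D; last first.
    by have -> : i = D by [apply/eqP; rewrite eqn_leq iD]; rewrite B_D !mul0r.
  by apply: ler_wpM2l => //; apply: le_trans (ler_normB _ _) _; rewrite mulrDr lerD ?IH.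
apply: ler_wpM2l => //; apply: le_trans (ler_normB _ _) _.
by rewrite mulrDr lerD ?IH // (leq_trans (leq_pred i)).
Qed.

(* Moments: the quadratic form of the [2 ^ n]-th power of the Laplacian grows at
   most like [K ^ (2 ^ n)] by [radial_bound], and by Cauchy-Schwarz at least like
   the [2 ^ n]-th power of the Rayleigh quotient. *)
Lemma laplacian_le f : \sum_y f y * laplacian f y <= K * \sum_y f y ^+ 2.
Proof.
set S := \sum_y f y ^+ 2; set q := \sum_y _; rewrite leNgt; apply/negP => lt.
have S_ge0 : 0 <= S by apply: sumr_ge0 => y _; apply: sqr_ge0.
have S_gt0 : 0 < S.
  rewrite lt_neqAle S_ge0 andbT eq_sym; apply/eqP => Sz.
  by move: lt; rewrite /q big1 ?Sz ?mulr0 ?ltxx // => y _; rewrite (sum_sqr_eq0 Sz) mul0r.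
have q_gt0 : 0 < q by apply: lt_trans lt; rewrite mulr_gt0.
pose a n := \sum_y f y * iter n laplacian f y.
have low n : S * (q / S) ^+ (2 ^ n) <= a (2 ^ n)%N.
  elim: n => [|n IH].
    by rewrite expn0 expr1 mulrC divfK ?gt_eqF.
  have := cauchy_schwarz f (iter (2 ^ n)%N laplacian f); rewrite -/S.
  have -> : \sum_y iter (2 ^ n)%N laplacian f y ^+ 2 = a (2 ^ n.+1)%N.
    rewrite expnS mul2n -addnn /a; under [RHS]eq_bigr do rewrite iterD.
    by rewrite -[RHS]iter_laplacian_adjoint; apply: eq_bigr => y _; rewrite expr2.
  rewrite -/(a _) => cs; rewrite -(ler_pM2l S_gt0); apply: le_trans cs.
  have -> : S * (S * (q / S) ^+ (2 ^ n.+1)) = (S * (q / S) ^+ (2 ^ n)) ^+ 2.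
    by rewrite expnSr exprM; ring.
  by rewrite ler_sqr ?nnegrE // ?(le_trans _ IH) // mulr_ge0 // exprn_ge0 // divr_ge0 // ltW.
pose M := \sum_y `|f y| * \sum_x w (d x y) * `|f x|.
have up n : a n <= K ^+ n * M.
  rewrite mulr_sumr; apply: ler_sum => y _; apply: le_trans (ler_norm _) _.
  rewrite normrM mulrCA; apply: ler_wpM2l; rewrite ?normr_ge0 // iter_laplacian mulr_sumr.
  apply: le_trans (ler_norm_sum _ _ _) _; apply: ler_sum => x _; rewrite normrM mulrA.
  by apply: ler_wpM2r; rewrite ?normr_ge0 // radial_bound // dist_le.
have x0 : 0 <= q / S / K by rewrite !divr_ge0 // ltW.
have /(power_bounded_le1 x0) : forall n, (q / S / K) ^+ (2 ^ n) <= M / S.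
  move=> n; rewrite expr_div_n ler_pdivrMr ?exprn_gt0 //.
  rewrite mulrAC ler_pdivlMr // mulrC [M * _]mulrC.
  exact: le_trans (low n) (up _).
rewrite ler_pdivrMr // mul1r ler_pdivrMr // leNgt; by rewrite lt.
Qed.

(** * The extremal eigenspace, and Delsarte's bound for cliques *)

Let u i : R := (-1) ^+ i * w i.

Let u0 : u 0%N = 1. Proof. by rewrite /u expr0 mul1r. Qed.
Let u1 : u 1%N = - w 1. Proof. by rewrite /u expr1 mulN1r. Qed.
Let u2 : u 2%N = w 2. Proof. by rewrite /u sqrrN expr1n mul1r. Qed.

Let eigen (g : V -> R) := forall y, laplacian g y = K * g y.

Lemma eigen_dist x : eigen (fun y => u (d x y)).
Proof.
move=> y; rewrite laplacian_radial /radial_laplacian /u; set i := d x y.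
have iD : (i <= D)%N by apply: dist_le.
rewrite [RHS]mulrCA -(wE iD) [RHS]mulrDr; congr (_ + _).
  by rewrite exprS; ring.
case: (i) => [|j]; first by rewrite /C /cext /= !mul0r mulr0.
by rewrite /= exprS; ring.
Qed.

(** The Laplacian is moved by self-adjointness from [g] to the indicator of the sphere. *)
Lemma sphere_sum_rec g x i : eigen g ->
  C i.+1 * \sum_(y | d x y == i.+1) g y =
    (B i + C i - K) * (\sum_(y | d x y == i) g y) -
    (if i is j.+1 then B j else 0) * \sum_(y | d x y == i.-1) g y.
Proof.
move=> eg; pose f l : R := if l == i then 1 else 0.
have sumE j : \sum_(y | d x y == j) g y = \sum_y (if d x y == j then 1 else 0) * g y.
  by rewrite big_mkcond; apply: eq_bigr => y _; case: eqP; rewrite ?mul1r ?mul0r.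
have h1 : \sum_y radial_laplacian f (d x y) * g y = K * \sum_(y | d x y == i) g y.
  under eq_bigr do rewrite -laplacian_radial.
  rewrite laplacian_adjoint sumE mulr_sumr; apply: eq_bigr => y _.
  by rewrite eg mulrCA.
have h2 : \sum_y radial_laplacian f (d x y) * g y =
    (B i + C i) * (\sum_(y | d x y == i) g y) - C i.+1 * (\sum_(y | d x y == i.+1) g y) -
    (if i is j.+1 then B j else 0) * (\sum_(y | d x y == i.-1) g y).
  rewrite !sumE !mulr_sumr -!sumrB; apply: eq_bigr => y _.
  by rewrite !mulrA -!mulrBl; congr (_ * _); apply: radial_delta.
by rewrite h1 in h2; rewrite mulrBl h2; ring.
Qed.

Lemma sphere_sum_eigen i : (i <= D)%N -> exists a : R, forall g, eigen g ->
  forall x, \sum_(y | d x y == i) g y = a * g x.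
Proof.
(* The recurrence has three terms, so the induction carries two consecutive radii. *)
suff h : (i <= D)%N ->
    (exists a : R, forall g, eigen g -> forall x, \sum_(y | d x y == i) g y = a * g x) /\
    (exists a : R, forall g, eigen g -> forall x, \sum_(y | d x y == i.-1) g y = a * g x).
  by move=> /h[].
elim: i => [|i IH] iD.
  have h0 g x : \sum_(y | d x y == 0%N) g y = 1 * g x.
    by rewrite (big_pred1 x) ?mul1r // => y; rewrite dist_eq0 eq_sym.
  by split; exists 1 => g _ x; apply: h0.
have [[a1 h1] [a2 h2]] := IH (ltnW iD); split; last by exists a1.
exists ((C i.+1)^-1 * ((B i + C i - K) * a1 - (if i is j.+1 then B j else 0) * a2)) => g eg x.
have C0 : C i.+1 != 0 by rewrite pnatr_eq0 -lt0n; apply: (c_gt0 drg).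
apply: (mulfI C0); rewrite (sphere_sum_rec x i eg) h1 // h2 //.
by rewrite -mulrA mulVKf //; ring.
Qed.

(** A positive multiple of the orthogonal projection onto the [K]-eigenspace of the Laplacian. *)
Let kernel (f : V -> R) (x : V) := \sum_y u (d x y) * f y.

Lemma kernel_eigen f : eigen (kernel f).
Proof.
move=> y; rewrite /kernel.
rewrite (@eq_laplacian _ (fun y => \sum_x u (d x y) * f x)); last first.
  by move=> z; apply: eq_bigr => x _; rewrite (dist_sym drg z).
rewrite laplacian_sum mulr_sumr; apply: eq_bigr => x _.
by rewrite eigen_dist (dist_sym drg y) mulrA.
Qed.

Lemma kernel_scale : exists2 a : R, 0 < a & forall g, eigen g ->
  forall x, kernel g x = a * g x.
Proof.
have [a ha] : exists a : R, forall g, eigen g -> forall x, kernel g x = a * g x.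
  have [a ha] : exists a : nat -> R, forall i, (i <= D)%N -> forall g, eigen g ->
      forall x, \sum_(y | d x y == i) g y = a i * g x.
    have /fin_all_exists[a ha] : forall i : 'I_D.+1, exists a : R, forall g, eigen g ->
        forall x, \sum_(y | d x y == i) g y = a * g x.
      by move=> i; apply: sphere_sum_eigen; rewrite -ltnS.
    exists (fun i => a (inord i)) => i iD g eg x.
    by have := ha (inord i) g eg x; rewrite inordK.
  exists (\sum_(i < D.+1) u i * a i) => g eg x.
  rewrite /kernel (partition_big (fun y => inord (d x y) : 'I_D.+1) xpredT) //= mulr_suml.
  apply: eq_bigr => i _; rewrite -mulrA -(ha i (ltnSE (ltn_ord i))) // mulr_sumr.
  have e y : (inord (d x y) == i) = (d x y == i).
    by rewrite -val_eqE /= inordK // ltnS dist_le.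
  by apply: eq_big => // y; rewrite e => /eqP->.
(* Evaluated at [x] on the eigenfunction [u (d x y)] of [y], the factor is a sum of squares with one
   term equal to 1. *)
exists a => //; have [x _] := drg.2.2.1.
have <- : kernel (fun y => u (d x y)) x = a.
  by rewrite (ha _ (eigen_dist x)) dist_xx u0 mulr1.
rewrite /kernel (bigD1 x) //= dist_xx u0 mulr1 ltr_pwDl ?ltr01 //.
by apply: sumr_ge0 => y _; rewrite -expr2 sqr_ge0.
Qed.

Lemma kernel_adjoint f g : \sum_x f x * kernel g x = \sum_x kernel f x * g x.
Proof.
rewrite /kernel; under eq_bigr do rewrite mulr_sumr.
rewrite exchange_big /=; apply: eq_bigr => y _; rewrite mulr_suml.
by apply: eq_bigr => x _; rewrite (dist_sym drg y); ring.
Qed.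

(** As [kernel f] is an eigenfunction, [a] times the quadratic form is the squared norm of
    [kernel f]. *)
Lemma kernel_psd f : 0 <= \sum_x f x * kernel f x /\
  (\sum_x f x * kernel f x = 0 -> forall x, kernel f x = 0).
Proof.
have [a a0 ha] := kernel_scale.
have e : a * \sum_x f x * kernel f x = \sum_x kernel f x ^+ 2.
  rewrite mulr_sumr; under eq_bigr do rewrite mulrCA -(ha _ (kernel_eigen f)).
  by rewrite kernel_adjoint; under eq_bigr do rewrite -expr2.
split.
  by rewrite -(pmulr_rge0 _ a0) e; apply: sumr_ge0 => x _; apply: sqr_ge0.
by move=> z; apply: sum_sqr_eq0; rewrite -e z mulr0.
Qed.

Lemma kernel_clique (A : {set V}) : is_clique E A ->
  \sum_x (x \in A)%:R * kernel (fun y => (y \in A)%:R) x = #|A|%:R * (1 - (#|A|%:R - 1) * w 1).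
Proof.
move=> cA; have sumA (F : V -> R) : \sum_x (x \in A)%:R * F x = \sum_(x in A) F x.
  by rewrite [RHS]big_mkcond; apply: eq_bigr => x _; case: ifP; rewrite ?mul1r ?mul0r.
rewrite sumA mulr_natl -sumr_const; apply: eq_bigr => x xA.
rewrite /kernel; under eq_bigr do rewrite mulrC.
rewrite sumA (bigD1 x) //= dist_xx u0; congr (_ + _).
rewrite (eq_bigr (fun=> u 1)); last first.
  move=> y /andP[yA xy]; congr (u _); apply/eqP; rewrite dist_eq1.
  by move/is_cliqueP: cA; apply; rewrite // eq_sym.
rewrite (eq_bigl (fun y => y \in A :\ x)); last by move=> y; rewrite !inE andbC.
by rewrite sumr_const (cardsD1 x A) xA u1 add1n -natr1 -[LHS]mulr_natl; ring.
Qed.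

Lemma clique_bound (A : {set V}) : is_clique E A -> A != set0 -> (#|A|%:R - 1) * w 1 <= 1.
Proof.
move=> cA A0; have := (kernel_psd (fun y => (y \in A)%:R)).1.
by rewrite kernel_clique // pmulr_rge0 ?ltr0n ?card_gt0 // subr_ge0.
Qed.

(** Equality in [clique_bound] puts the indicator of [A] in the null space of [kernel]; at [x] this
    reads as stated, since every vertex of [A] is at distance 1 or 2 from [x]. *)
Lemma delsarte_clique_nbrs (A : {set V}) x y : is_clique E A -> (#|A|%:R - 1) * w 1 = 1 ->
  x \notin A -> y \in A -> E x y ->
  #|[set z in A | E x z]|%:R * w 1 = (#|A|%:R - #|[set z in A | E x z]|%:R) * w 2.
Proof.
move=> cA dA xA yA Exy; have := (kernel_psd (fun y => (y \in A)%:R)).2.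
rewrite kernel_clique // dA subrr mulr0 => /(_ erefl x); rewrite /kernel.
have -> : \sum_z u (d x z) * (z \in A)%:R =
    \sum_(z in A) (u 2 + (if E x z then u 1 - u 2 else 0)).
  rewrite [RHS]big_mkcond; apply: eq_bigr => z _; case: ifP => [zA|]; rewrite ?mulr0 // mulr1.
  have [Exz|nE] := ifP.
    by rewrite addrC subrK; congr (u _); apply/eqP; rewrite dist_eq1.
  rewrite addr0 (dist_eq2 drg (z := y)) ?nE //; first by apply: contraNneq xA => ->.
  by move/is_cliqueP: cA; apply => //; apply: contraFneq nE => <-.
rewrite big_split /= sumr_const -big_mkcondr /=.
rewrite (eq_bigl (fun z => z \in [set z in A | E x z])); last by move=> z; rewrite inE.
by rewrite sumr_const -[u 2 *+ _]mulr_natl -[_ *+ #|_|]mulr_natl u1 u2 => h; lra.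
Qed.
End Spectrum.

(** * Classical parameters *)

Section ClassicalParameters.
Variables (R : archiRealFieldType) (V : finType) (E : rel V) (D b : nat).
Variables (bi ci : nat -> nat) (alpha beta : R).
Hypothesis drg : distance_regular E D bi ci.
Hypothesis cp : classical_params bi ci D b alpha beta.
Hypothesis b_ge2 : (2 <= b)%N.
Hypothesis D_ge3 : (3 <= D)%N.

Let r : R := (qint b D)%:R.
Let qi i : R := (qint b i)%:R.

Let lt_qi i : (i < D)%N -> qi i < r.
Proof. by move=> iD; rewrite ltr_nat ltn_qint // ltnW. Qed.

Let qi0 : qi 0 = 0. Proof. by rewrite /qi qint0. Qed.
Let qi1 : qi 1 = 1. Proof. by rewrite /qi qint1. Qed.

Let b_ge2R : 2 <= b%:R :> R.
Proof. by rewrite ler_nat. Qed.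

Let r_ge7 : 7 <= r.
Proof. by rewrite ler_nat qint_ge7. Qed.

Let D1 : (1 < D)%N := ltnW D_ge3.
Let D0 : (0 < D)%N := ltnW D1.

Lemma b0E : (bi 0)%:R = r * beta.
Proof. by rewrite (cp.1 _ D0) qint0 subr0 mulr0 subr0. Qed.

Lemma b1E : (bi 1)%:R = (r - 1) * (beta - alpha).
Proof. by rewrite (cp.1 _ D1) qint1 mulr1. Qed.

Lemma c1E : ci 1 = 1%N.
Proof.
apply/eqP; rewrite -(eqr_nat R) (cp.2 1%N) ?D0 //= qint0 qint1.
by rewrite mulr0 addr0 mulr1.
Qed.

Lemma c2E : (ci 2)%:R = (1 + b%:R) * (1 + alpha).
Proof. by rewrite cp.2 ?D1 //= qint2 qint1 mulr1 natrD. Qed.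

(** From $c_3 > 0$ follows $1 + \alpha(1+b) > 0$, that is $c_2 > b$; by integrality $c_2 \ge
    b+1$. *)
Lemma alpha_ge0 : 0 <= alpha.
Proof.
have c3 : 0 < (ci 3)%:R :> R by rewrite ltr0n (c_gt0 drg).
rewrite (cp.2 3) ?D_ge3 //= qint2 natrD pmulr_rgt0 in c3; last first.
  by rewrite ltr0n qintS addn_gt0 qint2.
have lt : (b < ci 2)%N by rewrite -(ltr_nat R) c2E; lra.
have : 1 + b%:R <= (ci 2)%:R :> R by rewrite nat1r ler_nat.
rewrite c2E mulrDr mulr1 lerDl pmulr_rge0 //; move: b_ge2R; lra.
Qed.

Lemma beta_gt i : (i < D)%N -> 0 < beta - alpha * qi i.
Proof.
move=> iD; have := b_gt0 drg iD; rewrite -(ltr0n R) (cp.1 _ iD) pmulr_rgt0 //.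
by rewrite subr_gt0 lt_qi.
Qed.

Lemma beta_gt0 : 0 < beta.
Proof. by have := beta_gt D0; rewrite qi0 mulr0 subr0. Qed.

Lemma bextE i : (i <= D)%N -> (bext D bi i)%:R = (r - qi i) * (beta - alpha * qi i).
Proof.
rewrite /bext; case: ltnP => [iD _|h1 h2]; first exact: cp.1.
by have -> : i = D by [apply/eqP; rewrite eqn_leq h1 h2]; rewrite subrr mul0r.
Qed.

Lemma cextE i : (i <= D)%N -> (cext ci i)%:R = qi i * (1 + alpha * qi i.-1).
Proof.
rewrite /cext; case: posnP => [->|h1 h2]; first by rewrite qi0 mul0r.
by apply: cp.2; rewrite h1.
Qed.

(* The absolute values of the cosine sequence of the least eigenvalue [- qint b D]. *)
Fixpoint wt i : R :=
  if i is j.+1 then wt j * ((1 + alpha * qi j) / (beta - alpha * qi j)) else 1.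

Lemma wt_gt0 i : (i <= D)%N -> 0 < wt i.
Proof.
elim: i => [|i IH] iD /=; first exact: ltr01.
apply: mulr_gt0; [exact: IH (ltnW iD) | apply: divr_gt0; last exact: beta_gt].
by rewrite ltr_pwDl ?ltr01 // mulr_ge0 ?alpha_ge0.
Qed.

Lemma wt_rec i : (i < D)%N -> wt i.+1 * (beta - alpha * qi i) = wt i * (1 + alpha * qi i).
Proof. by move=> iD; rewrite /= -mulrA divfK // gt_eqF // beta_gt. Qed.

(** By [wt_rec] all terms become multiples of [wt i], with coefficients adding up to $(r -
    [i])(\beta+1) + [i](\beta+1)$. *)
Lemma wtE i : (i <= D)%N ->
  (bext D bi i)%:R * (wt i + wt i.+1) + (cext ci i)%:R * (wt i + wt i.-1) =
  (r * beta + r) * wt i.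
Proof.
move=> iD; rewrite bextE // cextE //.
have eB : (r - qi i) * (beta - alpha * qi i) * wt i.+1 = (r - qi i) * (1 + alpha * qi i) * wt i.
  move: iD; rewrite leq_eqVlt => /predU1P[->|/wt_rec h]; first by rewrite subrr !mul0r.
  by rewrite -mulrA [_ * wt i.+1]mulrC h; ring.
have eC : qi i * (1 + alpha * qi i.-1) * wt i.-1 = qi i * (beta - alpha * qi i.-1) * wt i.
  case: i iD {eB} => [|i] iD; first by rewrite qi0 !mul0r.
  by rewrite -mulrA [_ * wt _]mulrC -(wt_rec iD); ring.
by rewrite [_ * (_ + wt i.+1)]mulrDr [_ * (_ + wt i.-1)]mulrDr eB eC; ring.
Qed.

Lemma wt1 : wt 1 = beta^-1.
Proof. by rewrite /= qi0 mulr0 subr0 addr0 mul1r mul1r. Qed.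

(** As the valency is $r\beta$, this says that $A + r$ is positive semidefinite. *)
Lemma laplacian_le_classical f :
  \sum_y f y * laplacian E f y <= (r * beta + r) * \sum_y f y ^+ 2.
Proof.
apply: (laplacian_le drg D0 (w := wt)) => //.
- exact: wt_gt0.
- by have := beta_gt0; have := r_ge7; nra.
- exact: wtE.
Qed.

Lemma clique_le (A : {set V}) : is_clique E A -> A != set0 -> #|A|%:R - 1 <= beta.
Proof.
move=> cA A0.
have := clique_bound drg D0 (w := wt) (erefl _) wtE cA A0.
by rewrite wt1 ler_pdivrMr ?beta_gt0 // mul1r.
Qed.

(** Inserting the first two weights gives $g(\beta-\alpha) = (\beta+1-g)(1+\alpha)$ for the number
    $g$ of neighbours. *)
Lemma delsarte_nbrs (A : {set V}) x y : is_clique E A -> #|A|%:R - 1 = beta ->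
  x \notin A -> y \in A -> E x y -> #|[set z in A | E x z]|%:R = 1 + alpha.
Proof.
move=> cA dA xA yA Exy.
have bn : beta != 0 by rewrite gt_eqF ?beta_gt0.
have dA1 : (#|A|%:R - 1) * wt 1 = 1 by rewrite dA wt1 divff.
have := delsarte_clique_nbrs drg D0 (w := wt) (erefl _) wtE cA dA1 xA yA Exy.
set g := #|_|%:R; have bg := beta_gt D1; have b0 := beta_gt0.
have := wt_rec D1; rewrite wt1 qi1 mulr1 in bg * => e2 h.
have {}h : g * (beta - alpha) = (#|A|%:R - g) * (1 + alpha).
  apply: (mulIf (invr_neq0 bn)); transitivity ((#|A|%:R - g) * (wt 2 * (beta - alpha))).
    by rewrite mulrA -h; ring.
  by rewrite e2; ring.
have eA : #|A|%:R = beta + 1 by rewrite -dA subrK.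
apply: (mulIf (x := beta + 1)); first by rewrite gt_eqF //; lra.
by rewrite eA in h; lra.
Qed.

End ClassicalParameters.

(** * The SPLS property for large $\beta$ *)

Section LargeBeta.
Variables (R : archiRealFieldType) (V : finType) (E : rel V) (D b : nat).
Variables (bi ci : nat -> nat) (alpha beta : R).
Hypothesis drg : distance_regular E D bi ci.
Hypothesis cp : classical_params bi ci D b alpha beta.
Hypothesis b_ge2 : (2 <= b)%N.
Hypothesis D_ge3 : (3 <= D)%N.
Hypothesis beta_large :
  3%:R^-1 * (8%:R * alpha * b%:R + 8%:R * b%:R + 5%:R * alpha) * (qint b D)%:R <= beta.

Let Esym : symmetric E := drg.1.1.
Let Eirr : irreflexive E := drg.1.2.
Let D2 : (1 < D)%N := ltnW D_ge3.
Let s := ((4 * qint b D) %/ 3)%N.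
Let m := (ci 2).-1.
Let lam := `|a1 bi ci|%N.
Let r : R := (qint b D)%:R.
Let L := SPLS_lines E bi ci (ci 2) s.

Let c2S : ci 2 = m.+1.
Proof. by rewrite prednK // (c_gt0 drg) // D2. Qed.

Let mE : m%:R = b%:R + alpha * b%:R + alpha.
Proof.
apply: (addIr 1); rewrite natr1 -c2S (c2E cp D_ge3); ring.
Qed.

(** The absolute value in [lam] is harmless, since $a_1$ counts common neighbours. *)
Let lamZ : lam%:Z = a1 bi ci.
Proof.
have [x [y dxy]] := sphere_nonempty drg (ltnW D2).
have Exy : E x y by rewrite -(dist_eq1 drg) dxy.
by rewrite /lam -(card_common_adj drg D2 Exy) absz_nat.
Qed.

Let lamE x y : E x y -> #|[set z | E x z && E y z]| = lam.
Proof. by move=> Exy; apply/eqP; rewrite -eqz_nat lamZ (card_common_adj drg D2 Exy). Qed.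

Let muE x y : x != y -> ~~ E x y -> (#|[set z | E x z && E y z]| <= m.+1)%N.
Proof. by rewrite -c2S; apply: (card_common_nonadj drg). Qed.

Let lamR : lam%:R = beta + (r - 1) * alpha - 1.
Proof.
have -> : lam%:R = (a1 bi ci)%:~R :> R by rewrite -lamZ.
rewrite /a1 !rmorphB /= -!pmulrn (c1E cp D_ge3) (b0E cp D_ge3) (b1E cp D_ge3).
by rewrite -/r; ring.
Qed.

Let alpha0 : 0 <= alpha.
Proof. exact: alpha_ge0 drg cp b_ge2 D_ge3. Qed.

Let r7 : 7 <= r.
Proof. by rewrite ler_nat qint_ge7. Qed.

Let s_bounds : 4 * r - 2 <= 3 * s%:R <= 4 * r.
Proof.
have h := divn_eq (4 * qint b D) 3; have l := ltn_pmod (4 * qint b D) (isT : (0 < 3)%N).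
rewrite -/s in h; have h1 : (3 * s <= 4 * qint b D)%N by lia.
have h2 : (4 * qint b D <= 3 * s + 2)%N by lia.
rewrite -(ler_nat R) natrM natrM -/r in h1.
rewrite -(ler_nat R) natrD natrM natrM -/r in h2.
by apply/andP; split; lra.
Qed.

Let s_gt1 : (1 < s)%N.
Proof. by have := qint_ge7 b_ge2 D_ge3; rewrite /s; lia. Qed.

Let s_gt0 : (0 < s)%N := ltnW s_gt1.

Let b2 : 2 <= b%:R :> R.
Proof. by rewrite ler_nat. Qed.

Let mR_ge : b%:R + alpha <= m%:R.
Proof. by rewrite mE lerD2r lerDl mulr_ge0. Qed.

(** The hypothesis on $\beta$ rewritten through $8\alpha b + 8b + 5\alpha = 8m - 3\alpha$. *)
Let beta_ge : 8 * (m%:R * r) - 3 * (alpha * r) <= 3 * beta.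
Proof.
have : 3 * (3%:R^-1 * (8%:R * alpha * b%:R + 8%:R * b%:R + 5%:R * alpha) * r) <= 3 * beta.
  by rewrite ler_pM2l.
by rewrite mE; apply: le_trans; rewrite le_eqVlt; apply/orP; left; apply/eqP; field.
Qed.

Let lam_ge : ((s.*2 - 1) * m <= lam)%N.
Proof.
have e : ((s.*2 - 1)%:R : R) = 2 * s%:R - 1.
  by rewrite natrB ?double_gt0 // -mul2n natrM.
rewrite -(ler_nat R) natrM e lamR.
have /andP[_ s1] := s_bounds.
have : m%:R * (3 * s%:R) <= m%:R * (4 * r) by rewrite ler_wpM2l.
by move: beta_ge mR_ge b2 alpha0; lra.
Qed.

Let k_lt : ((bi 0).*2 + s.+1 * s * m < s.+1.*2 * lam.+1)%N.
Proof.
rewrite -(ltr_nat R) natrD !natrM -!mul2n !natrM -[s.+1%:R]natr1 -[lam.+1%:R]natr1 lamR.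
rewrite (b0E cp D_ge3) -/r subrK.
have /andP[s1 s2] := s_bounds.
set S : R := s%:R in s1 s2 *.
have m0 : 0 < m%:R :> R by move: mR_ge b2 alpha0; lra.
(* The difference of both sides is increasing in [beta], hence at least its
   value at the lower bound of [beta_ge]. *)
have h1 : (S + 1 - r) * (8 * (m%:R * r) - 3 * (alpha * r)) <= (S + 1 - r) * (3 * beta).
  by rewrite ler_wpM2l //; move: r7; lra.
(* At that bound [m] has coefficient $((S+1)(16r-3S) - 16r^2)/3$, which is thus at least $4r/3$. *)
have h2 : 4 * r * (4 * r + 1) <= (S + 1) * (16 * r - 3 * S).
  have a1 : 4 * r + 1 <= 3 * (S + 1) by lra.
  have a2 : 12 * r <= 16 * r - 3 * S by lra.
  have : (4 * r + 1) * (12 * r) <= (3 * (S + 1)) * (16 * r - 3 * S).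
    by apply: ler_pM => //; move: r7; lra.
  by lra.
have h3 := ler_wpM2l (ltW m0) h2.
(* The terms in $\alpha$ add up to twice this quantity. *)
have h4 : 0 <= alpha * (r * r - (S + 1)).
  rewrite mulr_ge0 // subr_ge0; apply: (@le_trans _ _ (7 * r)); first by move: r7; lra.
  by rewrite ler_pM2r //; move: r7; lra.
have h5 : 0 < m%:R * r by rewrite mulr_gt0 //; move: r7; lra.
by lra.
Qed.

Let mem_L l : (l \in L) = is_line E lam m s l.
Proof.
rewrite /L inE /is_line c2S -lamZ; congr (_ && _).
have -> : (m.+1%:Z - 1) * (s%:Z - 1) = ((s - 1) * m)%N%:Z.
  by rewrite PoszM -subzn // mulrC -addn1 PoszD addrK.
by rewrite lerBlDr -!PoszD lez_nat.
Qed.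

Let L_inj l1 l2 x y : l1 \in L -> l2 \in L -> x != y ->
  x \in l1 -> y \in l1 -> x \in l2 -> y \in l2 -> l1 = l2.
Proof.
rewrite !mem_L; exact: (line_inj Esym Eirr lamE muE s_gt0 lam_ge).
Qed.

Let L_edge x y : E x y <-> x != y /\ exists l, [/\ l \in L, x \in l & y \in l].
Proof.
split=> [Exy|[xy [l [lL xl yl]]]].
  split; first by apply: contraTneq Exy => ->; rewrite Eirr.
  have [l [h1 h2 h3]] := edge_line Esym Eirr lamE muE s_gt0 lam_ge
    (degreeE drg (ltnW D2)) k_lt Exy.
  by exists l; rewrite mem_L.
by rewrite mem_L in lL; apply: (line_clique lL).
Qed.

Let collinearP x y : reflect (exists l, [/\ l \in L, x \in l & y \in l]) (collinear L x y).
Proof.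
apply: (iffP existsP) => [[l /and3P[]]|[l [h1 h2 h3]]]; exists l => //.
exact/and3P.
Qed.

Let L_clique l : l \in L -> is_clique E l.
Proof. by rewrite mem_L => /andP[/andP[]]. Qed.

Let card_L x : (#|[set l in L | x \in l]| <= s)%N.
Proof.
apply: leq_trans (card_lines Esym Eirr lamE muE s_gt0 lam_ge (degreeE drg (ltnW D2)) k_lt x).
by apply/subset_leq_card/subsetP => l; rewrite !inE -mem_L inE.
Qed.

Lemma SPLS_large_beta : SPLS E bi ci (ci 2) s.
Proof.
split; first by rewrite c2S.
split; first exact: s_gt1.
split; first by move=> x y xy l1 l2 L1 L2; apply: L_inj.
split.
  move=> x y xy; split; first by case/L_edge => _ h; apply/collinearP.
  by move/collinearP => h; apply/L_edge.
split.
  rewrite -lamZ c2S; have -> : m.+1%:Z - 1 = m by rewrite -addn1 PoszD addrK.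
  move: lam_ge; rewrite -lez_nat PoszM -subzn ?double_gt0 // mul2n.
  by [].
split; first exact: card_L.
move=> x l lL xl; rewrite [leqRHS]c2S.
have lL' := lL; rewrite mem_L in lL'.
apply: leq_trans (line_nbrs Esym muE lL' xl).
apply/subset_leq_card/subsetP => y; rewrite !inE => /andP[yl h].
rewrite yl; apply/L_edge; split; last exact: elimT (collinearP _ _) h.
by apply: contraNneq xl => ->.
Qed.

(** * Integrality of $\alpha$ and its upper bound *)

Let on x := #|[set l in L | x \in l]|.

Let sum_on (F : {set V} -> R) x :
  \sum_(l in L | x \in l) F l = \sum_(l in [set l in L | x \in l]) F l.
Proof. by apply: eq_bigl => l; rewrite [in RHS]inE. Qed.

(** Incidences are counted twice: a line has at least $s+1$ vertices and a vertex is on at most [s]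
    lines. *)
Let card_lines_lt : (#|L| < #|V|)%N.
Proof.
have m1 : (0 < m)%N by rewrite -(ltr0n R); move: mR_ge b2 alpha0; lra.
have h : (#|L| * s.+1 <= #|V| * s)%N.
  rewrite -!sum_nat_const; apply: (@leq_trans (\sum_(l in L) #|l|)).
    apply: leq_sum => l; rewrite mem_L => /(line_size s_gt0 lam_ge); apply: leq_trans.
    by rewrite -addn1 leq_add // leq_pmulr.
  apply: (@leq_trans (\sum_(x in V) on x)); last by apply: leq_sum => x _; apply: card_L.
  under eq_bigr do rewrite -sum1_card.
  rewrite (exchange_big_dep xpredT) //=; apply: leq_sum => x _.
  by rewrite /on -sum1_card; apply/eq_leq/eq_bigl => l; rewrite [in RHS]inE.
have [x _] := drg.2.2.1; have v0 : (0 < #|V|)%N by apply/card_gt0P; exists x.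
rewrite ltnNge; apply/negP => le.
by have := leq_trans (leq_mul le (leqnn s.+1)) h; rewrite leq_pmul2l // ltnn.
Qed.

Let delsarte x := forall l, l \in L -> x \in l -> #|l|%:R - 1 = beta.

Let line_sizes x : \sum_(l in [set l in L | x \in l]) (#|l|%:R - 1) = r * beta.
Proof.
rewrite -(b0E cp D_ge3) -(degreeE drg (ltnW D2) x) -sum_on.
transitivity (\sum_(l in L | x \in l) \sum_(y in l :\ x) 1 : R).
  apply: eq_bigr => l /andP[_ xl]; rewrite sumr_const (cardsD1 x l) xl add1n -natr1 addrK.
  by [].
rewrite (sum_over_lines L_edge L_inj) sumr_const.
by congr (_ *+ _); apply: eq_card => y; rewrite inE.
Qed.

Let line_le l x : l \in L -> x \in l -> #|l|%:R - 1 <= beta.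
Proof.
move=> lL xl; apply: (clique_le drg cp b_ge2 D_ge3); first exact: L_clique.
by apply/set0Pn; exists x.
Qed.

Let beta0 : 0 < beta.
Proof. exact: (beta_gt0 drg cp b_ge2 D_ge3). Qed.

(** Each line on [x] covers at most $\beta$ of its $r\beta$ neighbours. *)
Let on_ge x : r <= (on x)%:R.
Proof.
rewrite -(ler_pM2r beta0) -(line_sizes x) mulr_natl -sumr_const; apply: ler_sum => l.
by rewrite inE => /andP[lL xl]; apply: line_le xl.
Qed.

Let on_eq x : (on x)%:R = r -> delsarte x.
Proof.
move=> onx l lL xl.
have h : \sum_(l in [set l in L | x \in l]) (beta - (#|l|%:R - 1)) = 0.
  by rewrite sumrB line_sizes sumr_const -onx /on mulr_natl subrr.
apply/esym/eqP; rewrite -subr_eq0; apply/eqP; apply: (psumr_eq0P _ h).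
  by move=> l'; rewrite inE => /andP[lL' xl']; rewrite subr_ge0; apply: line_le xl'.
by rewrite inE lL.
Qed.

Lemma exists_delsarte_points : exists y w l,
  [/\ l \in L, y \in l, w \in l, y != w & delsarte y /\ delsarte w].
Proof.
have [z [y zy] zL] := exists_zero_sum R card_lines_lt.
have supp x : z x != 0 -> delsarte x.
  (* Each line on [t] contributes [- z t] to the sum of [z] over the neighbours of [t]. *)
  have lapz t : laplacian E z t = (r * beta + (on t)%:R) * z t.
    rewrite /laplacian sumrB sumr_const.
    have -> : #|[pred y | E t y]| = bi 0.
      by rewrite -(degreeE drg (ltnW D2) t); apply: eq_card => ?; rewrite !inE.
    rewrite -(sum_over_lines L_edge L_inj) sum_on.
    rewrite (eq_bigr (fun=> - z t)); last first.
      move=> l; rewrite inE => /andP[/zL zl tl].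
      by apply/eqP; rewrite -addr_eq0 addrC -big_setD1 ?zl.
    by rewrite sumr_const -/(on t) mulrDl -(b0E cp D_ge3) !mulr_natl mulNrn opprK.
  have := laplacian_le_classical drg cp b_ge2 D_ge3 z.
  rewrite mulr_sumr -subr_le0 -sumrB.
  have nn t : 0 <= ((on t)%:R - r) * z t ^+ 2 by rewrite mulr_ge0 ?sqr_ge0 // subr_ge0.
  rewrite (eq_bigr (fun t => ((on t)%:R - r) * z t ^+ 2)); last first.
    by move=> t _; rewrite lapz; ring.
  (* A sum of nonnegative terms is at most zero, so [on t] is [r] wherever [z] is nonzero. *)
  move=> le0; have eq0 : \sum_t ((on t)%:R - r) * z t ^+ 2 = 0.
    by apply/eqP; rewrite eq_le le0 sumr_ge0.
  move=> zx; apply: on_eq; apply/eqP; rewrite -subr_eq0.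
  have /eqP := psumr_eq0P (fun i _ => nn i) eq0 (i := x) isT.
  by rewrite mulf_eq0 sqrf_eq0 (negPf zx) orbF.
have [l] : exists l, l \in [set l in L | y \in l].
  by apply/card_gt0P; rewrite -(ltr0n R) (lt_le_trans _ (on_ge y)) //; move: r7; lra.
rewrite inE => /andP[lL yl].
(* A line meeting the support in [y] alone could not have sum zero. *)
have [w wl zw] : exists2 w, w \in l :\ y & z w != 0.
  apply/exists_inP; apply: contraT => /exists_inPn h; case/eqP: zy.
  have := zL l lL; rewrite (big_setD1 y) //= big1 ?addr0 // => w /h.
  by rewrite negbK => /eqP.
move: wl; rewrite !inE eq_sym => /andP[yw wl].
by exists y, w, l; split=> //; split; apply: supp.
Qed.

Lemma alpha_int_le : alpha \is a Num.int /\ alpha <= b%:R.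
Proof.
have [y [w [l [lL yl wl yw [dy dw]]]]] := exists_delsarte_points.
have Eyw : E y w by apply/L_edge; split=> //; exists l.
(* A second line on [w] misses [y] but meets its neighbourhood in [w], so it contains $1+\alpha$
   neighbours of [y]. *)
have [l'] : exists l', l' \in [set l in L | w \in l] :\ l.
  apply/card_gt0P; have : (1 < on w)%N.
    by rewrite -(ltr_nat R) (lt_le_trans _ (on_ge w)) //; move: r7; lra.
  by rewrite /on (cardsD1 l) inE lL wl.
rewrite in_setD1 in_set => /and3P[l'l l'L wl'].
have yl' : y \notin l'.
  by apply: contraNN l'l => yl'; rewrite (L_inj l'L lL yw).
have g1 := delsarte_nbrs drg cp b_ge2 D_ge3 (L_clique l'L) (dw l' l'L wl') yl' wl' Eyw.
split.
  by rewrite -[alpha](addKr 1) -g1; apply: rpredD; rewrite ?rpredN ?rpred1 ?rpred_nat.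
have /(maxclique_nonadj Esym)/(_ yl')[x xl' /andP[yx nyx]] : is_maxclique E l'.
  by move: l'L; rewrite mem_L => /andP[].
have wx : w != x by apply: contraNneq nyx => <-.
have Exw : E x w by apply/L_edge; split; [rewrite eq_sym | exists l'].
have xy : x != y by rewrite eq_sym.
have nxy : ~~ E x y by rewrite Esym.
have dxy : dist drg x y = 2 by apply: (dist_eq2 drg xy nxy Exw); rewrite Esym.
pose F := [set l in L | (y \in l) && [exists v in l, E x v]].
(* The $c_2 = (1+b)(1+\alpha)$ common neighbours of [x] and [y] are split among the lines of [F],
   with $1+\alpha$ on each. *)
have cF : #|F| = (1 + b)%N.
  have a1 : 1 + alpha != 0 by rewrite gt_eqF //; move: alpha0; lra.
  apply/eqP; rewrite -(eqr_nat R); apply/eqP; apply: (mulIf a1).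
  rewrite natrD -(c2E cp D_ge3) -(card_common_dist2 dxy) -[in RHS]sum1_card natr_sum.
  rewrite (eq_bigl (fun z => E y z && E x z)); last by move=> z; rewrite inE andbC.
  rewrite big_mkcondr -(sum_over_lines L_edge L_inj) /= mulr_natl -sumr_const.
  rewrite big_mkcond [RHS]big_mkcond; apply: eq_bigr => l1 _.
  rewrite [l1 \in F]inE; case: (boolP (l1 \in L)) => //= L1.
  case: (boolP (y \in l1)) => //= y1.
  have e : \sum_(v in l1 :\ y) (if E x v then 1 else 0) = #|[set v in l1 | E x v]|%:R :> R.
    rewrite -big_mkcondr -sum1_card natr_sum; apply: eq_bigl => v; rewrite !inE.
    by case: eqVneq => //= ->; rewrite (negPf nxy) andbF.
  rewrite e; case: ifP => [/exists_inP[v v1 Exv]|/negbT/exists_inPn h].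
    rewrite (delsarte_nbrs drg cp b_ge2 D_ge3 (L_clique L1) (dy l1 L1 y1) _ v1 Exv) //.
    apply: contra nxy => x1; apply/L_edge; split=> //; by exists l1.
  by rewrite (_ : [set v in l1 | _] = set0) ?cards0 //; apply/setP => v; rewrite !inE;
     apply/negP => /andP[/h/negP].
suff le : (#|[set z in l' | E y z]| <= #|F|)%N.
  by rewrite cF -(ler_nat R) g1 natrD in le; move: le; lra.
(* [f] sends a neighbour [v] of [y] on [l'] to the line joining it to [y]. This line is in [F], as
   [v] is adjacent to [x]; two such [v] on one line would make it [l'], which misses [y]. *)
pose f v := odflt set0 [pick l | [&& l \in L, y \in l & v \in l]].
have fP v : v \in [set z in l' | E y z] -> [/\ f v \in L, y \in f v & v \in f v].
  rewrite inE => /andP[_ /L_edge[_ [l1 [h1 h2 h3]]]].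
  by rewrite /f; case: pickP => [l2 /and3P//|/(_ l1)]; rewrite h1 h2 h3.
rewrite -(card_in_imset (f := f)) => [|u v uS vS fuv].
  apply/subset_leq_card/subsetP => l1 /imsetP[v vS ->]; have [h1 h2 h3] := fP v vS.
  rewrite inE h1 h2 /=; apply/exists_inP; exists v => //.
  move: vS; rewrite inE => /andP[vl' Eyv]; apply/L_edge; split; last by exists l'.
  by apply: contraNneq nyx => ->.
apply: contraNeq yl' => uv; have [u1 u2 u3] := fP u uS; have [_ _ v3] := fP v vS.
move: uS vS; rewrite !inE => /andP[ul' _] /andP[vl' _].
by rewrite (L_inj l'L u1 uv) // fuv.
Qed.

End LargeBeta.

Theorem theorem14 (R : archiRealFieldType) (V : finType) (E : rel V)
  (D b : nat) (bi ci : nat -> nat) (alpha beta : R) :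
  distance_regular E D bi ci ->
  classical_params bi ci D b alpha beta ->
  (2 <= b)%N -> (3 <= D)%N ->
  (((3%:R)^-1 * (8%:R * alpha * b%:R + 8%:R * b%:R + 5%:R * alpha) * (qint b D)%:R
     <= beta)%R) ->
  SPLS E bi ci (ci 2%N) ((4 * qint b D) %/ 3) /\
  (alpha \is a Num.int)%R /\ (0 <= alpha)%R /\ (alpha <= b%:R)%R.
Proof.
move=> drg cp b2 D3 large.
have [int_alpha le_alpha] := alpha_int_le drg cp b2 D3 large.
split; first exact: SPLS_large_beta cp b2 D3 large.
by split=> //; split=> //; apply: alpha_ge0 drg cp b2 D3.
Qed.
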